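(* For every PX instance $D=(V,A,c)$, the Top Trading Cycles procedure described in the context terminates and returns a Pareto optimal (balanced) exchange $(\mathcal{C},f)$.
   Context: A PX instance consists of a finite directed graph $D=(V,A)$ without loops or parallel arcs, a capacity function $c:A\to\mathbb{R}_{>0}$, and, for each agent $v\in V$, a strict total order $>_v$ (the preference list of $v$) on the set $\{u:(v,u)\in A\}$; $u_1>_v u_2$ means $v$ prefers $u_1$ to $u_2$. A packing is a finite set $\mathcal{C}$ of directed cycles of $D$ (cycles visit pairwise distinct vertices). For $e\in A$ let $\mathcal{C}_e$ be the set of cycles of $\mathcal{C}$ containing $e$. An exchange function is a map $f:\mathcal{C}\to\mathbb{R}_{>0}$ such that $f(e):=\sum_{C\in\mathcal{C}_e}f(C)\le c(e)$ for every $e\in A$ (so $f(e)=0$ if no cycle of $\mathcal{C}$ contains $e$). An exchange is a pair $(\mathcal{C},f)$ with $\mathcal{C}$ a packing and $f$ an exchange function. If $v$ has preference list $v_1>_v v_2>_v\cdots>_v v_z$, then $v$ prefers $(\mathcal{C},f)$ to $(\mathcal{C}',f')$, written $(\mathcal{C},f)>_v(\mathcal{C}',f')$, if there is $k\in\{1,\dots,z\}$ with $f((v,v_i))=f'((v,v_i))$ for $i<k$ and $f((v,v_k))>f'((v,v_k))$. $(\mathcal{C}',f')$ dominates $(\mathcal{C},f)$ if there is no agent $v$ with $(\mathcal{C},f)>_v(\mathcal{C}',f')$ and there is some agent $u$ with $(\mathcal{C}',f')>_u(\mathcal{C},f)$. An exchange is Pareto optimal if no exchange dominates it. The procedure: initialise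 $\mathcal{C}=\emptyset$, a working graph $H:=D$ with residual capacities $r:=c$, and $k=1$. Round $k$: (1) form the directed graph $G^k$ on the vertex set of $H$ which has, for each vertex $v$ of $H$ having at least one outgoing arc in $H$, exactly one arc $(v,g(v))$, where $g(v)$ is the $>_v$-most preferred vertex among those $u$ with $(v,u)$ an arc of $H$; (2) let $\mathcal{C}^k$ be the set of directed cycles of $G^k$ and set $\mathcal{C}\leftarrow\mathcal{C}\cup\mathcal{C}^k$; (3) for each $C\in\mathcal{C}^k$ set $f(C)=\min_{e\in C}r(e)$ and decrease $r(e)$ by $f(C)$ for every arc $e$ of $C$; delete from $H$ every arc $e$ with $r(e)=0$; (4) repeatedly delete from $H$ every vertex with no outgoing arc in $H$ (together with its incident arcs); (5) if $H$ is empty, return $(\mathcal{C},f)$; otherwise set $k\leftarrow k+1$ and start the next round. *)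

(* Defs.v *)
From mathcomp Require Import all_boot all_order all_algebra.
From mathcomp Require Import boolp reals.

Set Implicit Arguments.
Unset Strict Implicit.
Unset Printing Implicit Defensive.

Import Order.TTheory GRing.Theory Num.Theory.

Local Open Scope ring_scope.

(* Outside [arcs], [cap] and [pref] are unconstrained and never consulted.
   [pref D v u1 u2] reads u1 >_v u2. *)
Record px_instance (R : realType) (V : finType) := PXInstance {
  arcs : {set V * V};
  cap : V * V -> R;
  pref : V -> rel V;
  arcs_loopless : forall v, (v, v) \notin arcs;
  cap_gt0 : forall e, e \in arcs -> 0 < cap e;
  pref_irr : forall v u, (v, u) \in arcs -> ~~ pref v u u;
  pref_trans : forall v u1 u2 u3,
    (v, u1) \in arcs -> (v, u2) \in arcs -> (v, u3) \in arcs ->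
    pref v u1 u2 -> pref v u2 u3 -> pref v u1 u3;
  pref_total : forall v u1 u2,
    (v, u1) \in arcs -> (v, u2) \in arcs -> u1 != u2 ->
    pref v u1 u2 || pref v u2 u1
}.

(* A directed cycle is represented by its set of arcs, so that the rotations of
   a cyclic vertex sequence denote the same cycle. *)
Definition dicycle (V : finType) (E C : {set V * V}) : Prop :=
  exists s : seq V,
    [/\ s != [::], ucycle (fun x y => (x, y) \in E) s
      & C = [set (x, next s x) | x in s]].

(* Values of [xfun] outside [packing] are irrelevant. *)
Record exchange (R : realType) (V : finType) := Exchange {
  packing : {set {set V * V}};
  xfun : {ffun {set V * V} -> R}
}.

Section Exchanges.
Variables (R : realType) (V : finType) (D : px_instance R V).
Implicit Types X Y : exchange R V.

Definition flow X (e : V * V) : R :=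
  \sum_(C in packing X | e \in C) xfun X C.

Definition is_exchange X : Prop :=
  [/\ forall C, C \in packing X -> dicycle (arcs D) C,
      forall C, C \in packing X -> 0 < xfun X C
    & forall e, e \in arcs D -> flow X e <= cap D e].

Definition balanced X : Prop :=
  forall v, \sum_(u | (v, u) \in arcs D) flow X (v, u) =
            \sum_(u | (u, v) \in arcs D) flow X (u, v).

(* The witness [u] is the k-th entry of the preference list of [v]; the entries
   of index i < k are exactly the out-neighbours that [v] prefers to [u]. *)
Definition prefers (v : V) X Y : Prop :=
  exists u, [/\ (v, u) \in arcs D,
    forall w, (v, w) \in arcs D -> pref D v w u ->
      flow X (v, w) = flow Y (v, w)
    & flow Y (v, u) < flow X (v, u)].

Definition dominates Y X : Prop :=
  ~ (exists v, prefers v X Y) /\ (exists u, prefers u Y X).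

Definition pareto_optimal X : Prop :=
  ~ (exists Y, is_exchange Y /\ dominates Y X).

End Exchanges.

Record ttc_state (R : realType) (V : finType) := TTCState {
  st_verts : {set V};
  st_arcs : {set V * V};
  st_res : {ffun V * V -> R};
  st_packing : {set {set V * V}};
  st_fun : {ffun {set V * V} -> R}
}.

Section TopTradingCycles.
Variables (R : realType) (V : finType) (D : px_instance R V).
Implicit Types st : ttc_state R V.

Definition ttc_init : ttc_state R V :=
  TTCState [set: V] (arcs D) [ffun e => cap D e] set0 [ffun=> 0].

Definition top_choice (E : {set V * V}) (v : V) : option V :=
  [pick u | ((v, u) \in E) &&
    [forall w, ((v, w) \in E) && (w != u) ==> pref D v u w]].

Definition top_graph (E : {set V * V}) : {set V * V} :=
  [set e | top_choice E e.1 == Some e.2].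

Definition dicycles (E : {set V * V}) : {set {set V * V}} :=
  [set C | `[< dicycle E C >]].

(* The default value 0 is for the empty set, which is not a cycle. *)
Definition min_on (r : {ffun V * V -> R}) (C : {set V * V}) : R :=
  if [pick e in C] is Some e0 then r [arg min_(e < e0 in C) r e]%O else 0.

Definition trade_cycle st (C : {set V * V}) : ttc_state R V :=
  let m := min_on (st_res st) C in
  TTCState (st_verts st) (st_arcs st)
    [ffun e => if e \in C then st_res st e - m else st_res st e]
    (C |: st_packing st)
    [ffun B => if B == C then m else st_fun st B].

(* The cycles of a top graph are pairwise vertex-disjoint, so the order in which
   they are processed is immaterial. *)
Definition trade st : ttc_state R V :=
  foldl trade_cycle st (enum (dicycles (top_graph (st_arcs st)))).

Definition drop_saturated st : ttc_state R V :=
  TTCState (st_verts st) [set e in st_arcs st | st_res st e != 0]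
    (st_res st) (st_packing st) (st_fun st).

Definition drop_sinks st : ttc_state R V :=
  let W := [set v in st_verts st | [exists u, (v, u) \in st_arcs st]] in
  TTCState W [set e in st_arcs st | (e.1 \in W) && (e.2 \in W)]
    (st_res st) (st_packing st) (st_fun st).

(* Every call of [drop_sinks] before stabilisation deletes a vertex, so #|V|
   iterations reach the fixpoint. *)
Definition prune st : ttc_state R V := iter #|V| drop_sinks st.

Definition ttc_round st : ttc_state R V := prune (drop_saturated (trade st)).

Definition st_output st : exchange R V := Exchange (st_packing st) (st_fun st).

(* [ttc_run st X]: started with a round at [st], the procedure stops after
   finitely many rounds and returns [X]. *)
Inductive ttc_run : ttc_state R V -> exchange R V -> Prop :=
| ttc_stop st :
    st_verts (ttc_round st) = set0 ->
    ttc_run st (st_output (ttc_round st))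
| ttc_next st X :
    st_verts (ttc_round st) <> set0 ->
    ttc_run (ttc_round st) X ->
    ttc_run st X.

End TopTradingCycles.

(* Main.v *)
(* A deleted arc is settled: every exchange that no agent finds worse than the
   flow built so far carries the same flow on it.  A saturated arc is settled
   because the arcs its tail prefers were deleted before it was used, so the
   tail insists on a flow that already meets the capacity.  If all arcs leaving
   a vertex are settled, its total inflow is determined by conservation; each
   arc entering it has at least the current flow, again because its tail
   insists on it, so these arcs are settled as well.  At the end every arc has
   been deleted.  For termination, once the vertices without out-arcs have been
   removed the top graph has a cycle, so a round saturates at least one arc. *)
Require Import Defs.
From mathcomp Require Import all_boot all_order all_algebra.
From mathcomp Require Import boolp reals.

Set Implicit Arguments.
Unset Strict Implicit.
Unset Printing Implicit Defensive.

Import Order.TTheory GRing.Theory Num.Theory.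

Local Open Scope ring_scope.

(** * Directed cycles as sets of arcs *)

Section Dicycles.
Variable V : finType.
Implicit Types (E C : {set V * V}) (s : seq V).

Lemma mem_next_arcs s v u :
  ((v, u) \in [set (x, next s x) | x in s]) = (v \in s) && (u == next s v).
Proof.
apply/imsetP/andP => [[x xs [-> ->]]|[vs /eqP->]]; first by rewrite eqxx.
by exists v.
Qed.

Lemma dicycle_sub E C : dicycle E C -> C \subset E.
Proof.
move=> [s [_ /andP[cs us] ->]]; apply/subsetP => -[x y].
by rewrite mem_next_arcs => /andP[xs /eqP->]; exact: next_cycle cs xs.
Qed.

Lemma dicycleS E E' C : E \subset E' -> dicycle E C -> dicycle E' C.
Proof.
move=> /subsetP sEE' [s [s0 /andP[cs us] ->]]; exists s; split=> //.
rewrite /ucycle us andbT; apply: sub_cycle cs => x y; exact: sEE'.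
Qed.

Lemma dicycle_neq0 E C : dicycle E C -> exists e, e \in C.
Proof.
move=> [[|x s] [//= _ _ ->]]; exists (x, next (x :: s) x).
exact/imset_f/mem_head.
Qed.

(** On the cycle the only neighbours of [v] are [next s v] and [prev s v], so both counts are 1; off
    it both are 0. *)
Lemma dicycle_degree E C v : dicycle E C ->
  #|[pred u | (v, u) \in C]| = #|[pred u | (u, v) \in C]|.
Proof.
move=> [s [_ /andP[_ us] ->]]; have [vs|vNs] := boolP (v \in s).
  transitivity 1%N.
    rewrite -(card1 (next s v)); apply: eq_card => u.
    by rewrite -!topredE /= mem_next_arcs vs.
  rewrite -(card1 (prev s v)); apply: eq_card => u.
  rewrite -!topredE /= mem_next_arcs; apply/eqP/andP => [->|[_ /eqP->]].
    by rewrite mem_prev vs next_prev.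
  by rewrite prev_next.
rewrite !eq_card0// => u; rewrite -!topredE /= mem_next_arcs.
  by apply/negP => /andP[us' /eqP vE]; rewrite vE mem_next us' in vNs.
by rewrite (negPf vNs).
Qed.

End Dicycles.

Section TopTradingCyclesTheory.
Variables (R : realType) (V : finType) (D : px_instance R V).
Implicit Types (E C : {set V * V}) (X Y : exchange R V) (st : ttc_state R V).

(** * Flow conservation and comparison of exchanges *)

Lemma flow_ge0 X e : is_exchange D X -> 0 <= flow X e.
Proof. by move=> [_ f0 _]; apply: sumr_ge0 => C /andP[CX _]; exact/ltW/f0. Qed.

(** After swapping the sums, each cycle contributes its value once per arc at [v], and it leaves [v]
    as often as it enters. Conservation is later applied to a competing exchange as well. *)
Lemma is_exchange_balanced X : is_exchange D X -> balanced D X.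
Proof.
move=> [cX _ _] v.
rewrite /flow (exchange_big_dep (fun C => C \in packing X)) /=; last first.
  by move=> u C _ /andP[].
rewrite [RHS](exchange_big_dep (fun C => C \in packing X)) /=; last first.
  by move=> u C _ /andP[].
apply: eq_bigr => C CX; rewrite !sumr_const; congr (_ *+ _).
have /subsetP sC := dicycle_sub (cX _ CX).
have := dicycle_degree v (cX _ CX).
have -> : #|[pred u | (v, u) \in C]| =
    #|[pred u | (v, u) \in arcs D & (C \in packing X) && ((v, u) \in C)]|.
  apply: eq_card => u; rewrite !inE CX /=.
  by apply/idP/andP => [uC|[]//]; rewrite uC sC.
move=> ->; apply: eq_card => u; rewrite inE [RHS]unfold_in CX /=.
by apply/idP/andP => [uC|[]//]; rewrite uC sC.
Qed.

Lemma not_prefers_le v u X Y : ~ prefers D v X Y -> (v, u) \in arcs D ->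
  (forall w, (v, w) \in arcs D -> pref D v w u ->
    flow X (v, w) = flow Y (v, w)) ->
  flow X (v, u) <= flow Y (v, u).
Proof.
by move=> nXY vu eXY; rewrite leNgt; apply/negP => lt; apply: nXY; exists u.
Qed.


(** * Top graphs and their cycles *)

Lemma pref_asym v u w : (v, u) \in arcs D -> (v, w) \in arcs D ->
  pref D v u w -> ~~ pref D v w u.
Proof.
move=> vu vw uw; apply/negP => wu.
by have := pref_trans vu vw vu uw wu; rewrite (negPf (pref_irr vu)).
Qed.

Lemma mem_top_graph E v u : (v, u) \in top_graph D E ->
  (v, u) \in E /\ forall w, (v, w) \in E -> w != u -> pref D v u w.
Proof.
rewrite inE /= /top_choice; case: pickP => //= x /andP[vx /forallP top].
move=> /eqP[<-]; split=> // w vw wx.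
by have := top w; rewrite vw wx.
Qed.

Lemma top_graph_sub E : top_graph D E \subset E.
Proof. by apply/subsetP => -[v u] /mem_top_graph[]. Qed.

(** The top choice is the out-neighbour with the most out-neighbours ranked below it: if [w] were
    preferred to [x], then [below w] would contain [below x] and also [x] itself. *)
Lemma top_choice_exists E v u : E \subset arcs D -> (v, u) \in E ->
  exists x, (v, x) \in top_graph D E.
Proof.
move=> /subsetP sE vu.
pose below x := [set w | ((v, w) \in E) && pref D v x w].
case: (@arg_maxnP _ u (fun x => (v, x) \in E) (fun x => #|below x|) vu).
move=> x vx xmax; suff: top_choice D E v != None.
  by case E1: (top_choice D E v) => [y|//] _; exists y; rewrite inE /= E1.
rewrite /top_choice; case: pickP => // /(_ x) /negP[].
rewrite vx /=; apply/forallP => w; apply/implyP => /andP[vw wx].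
have /orP[wpx|//] := pref_total (sE _ vw) (sE _ vx) wx.
have := xmax w vw; rewrite /= leqNgt => /negP[]; apply: proper_card.
apply/properP; split.
  apply/subsetP => y; rewrite !inE => /andP[vy xy]; rewrite vy.
  exact: pref_trans (sE _ vw) (sE _ vx) (sE _ vy) wpx xy.
by exists x; rewrite !inE vx //= (negPf (pref_irr (sE _ vx))).
Qed.

Lemma mem_top_graph_odflt E v u :
  (v, u) \in top_graph D E -> odflt v (top_choice D E v) = u.
Proof. by rewrite inE => /eqP /= ->. Qed.

(** A top graph is the graph of a partial function, so a cycle is the orbit of any of its vertices;
    sharing the tail of [e] already forces equality. *)
Lemma top_cycle_inj E C C' e :
  dicycle (top_graph D E) C -> dicycle (top_graph D E) C' ->
  e \in C -> e \in C' -> C = C'.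
Proof.
pose g x := odflt x (top_choice D E x).
have fcycleP s : cycle (fun x y => (x, y) \in top_graph D E) s -> fcycle g s.
  by apply: sub_cycle => x y /mem_top_graph_odflt /= <-.
case: e => x y [s [_ /andP[cs us] ->]] [t [_ /andP[ct ut] ->]].
rewrite !mem_next_arcs => /andP[xs _] /andP[xt _].
have st : s =i t.
  move=> z; have := fconnect_cycle (fcycleP _ cs) xs z.
  by rewrite (fconnect_cycle (fcycleP _ ct) xt).
apply/setP => -[a b]; rewrite !mem_next_arcs st; apply: andb_id2l => at_.
congr (_ == _); have as_ : a \in s by rewrite st.
by rewrite -(eqP (next_cycle (fcycleP _ cs) as_))
  -(eqP (next_cycle (fcycleP _ ct) at_)).
Qed.

Lemma top_cycle_exists E (A : {set V}) : E \subset arcs D -> A != set0 ->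
  (forall e, e \in E -> e.2 \in A) ->
  (forall v, v \in A -> exists u, (v, u) \in E) ->
  exists C, dicycle (top_graph D E) C.
Proof.
move=> sE /set0Pn[x xA] EA AE.
pose g x := odflt x (top_choice D E x).
have gE v : v \in A -> (v, g v) \in top_graph D E.
  move=> vA; have [u vu] := AE _ vA; have [w vw] := top_choice_exists sE vu.
  by rewrite /g (mem_top_graph_odflt vw).
have gA v : v \in A -> g v \in A.
  by move=> /gE/(subsetP (top_graph_sub _)) /EA.
have iA i v : v \in A -> iter i g v \in A by move=> vA; elim: i => //= i /gA.
(* By finiteness the walk along top choices from [x] revisits its [i]-th vertex, which therefore
   lies on a cycle. *)
have /trajectP[i lti yE] := looping_order g x.
pose y := iter i g x.
have cy : fcycle g (orbit g y).
  (* Item 3 asks for a return to [y] after [k.+1] steps, hence the predecessor of the gap between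
     the two visits. *)
  apply/(orbitPcycle 0 3); exists (fingraph.order g x - i).-1.
  by rewrite prednK ?subn_gt0// /y -iterD subnK// ltnW.
exists [set (z, next (orbit g y) z) | z in orbit g y]; exists (orbit g y).
split=> //; first by rewrite /orbit -size_eq0 size_traject -lt0n order_gt0.
rewrite /ucycle orbit_uniq andbT.
have oA : all (mem A) (orbit g y).
  by apply/allP => z /trajectP[j _ ->]; apply/iA/iA.
by apply: (sub_in_cycle _ oA) cy => a b aA _ /= /eqP<-; exact: gE.
Qed.

(** * Bottleneck of a cycle and loop invariant *)

Lemma min_onP (r : {ffun V * V -> R}) C e : e \in C ->
  exists2 m, m \in C & min_on r C = r m /\ forall e', e' \in C -> r m <= r e'.
Proof.
move=> eC; rewrite /min_on; case: pickP => [e0 e0C|/(_ e)]; last by rewrite eC.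
by case: arg_minP => // m mC mmin; exists m.
Qed.

(** [inv_pref] and [inv_settled] work together: on an arc with positive flow, the arcs its tail
    prefers are deleted, hence settled, and [not_prefers_le] then bounds the flow of [Y] from
    below. *)
Record ttc_inv st : Prop := TTCInv {
  inv_sub : st_arcs st \subset arcs D;
  inv_ends : forall e, e \in st_arcs st ->
    (e.1 \in st_verts st) && (e.2 \in st_verts st);
  inv_cycle : forall C, C \in st_packing st -> dicycle (arcs D) C;
  inv_fun : forall C, C \in st_packing st -> 0 < st_fun st C;
  inv_res : forall e, e \in arcs D ->
    flow (st_output st) e + st_res st e = cap D e;
  inv_res_ge0 : forall e, e \in arcs D -> 0 <= st_res st e;
  inv_pref : forall v u w, 0 < flow (st_output st) (v, u) ->
    (v, u) \in arcs D -> (v, w) \in arcs D -> pref D v w u ->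
    (v, w) \notin st_arcs st;
  (* [inv_cut] prevents a cycle from being traded twice, which would overwrite
     its recorded amount. *)
  inv_cut : forall C, C \in st_packing st ->
    exists2 e, e \in C & (e \notin st_arcs st) || (st_res st e == 0);
  inv_settled : forall Y, is_exchange D Y ->
    (forall v, ~ prefers D v (st_output st) Y) ->
    forall e, e \in arcs D -> e \notin st_arcs st ->
    flow Y e = flow (st_output st) e
}.

Lemma inv_exchange st : ttc_inv st -> is_exchange D (st_output st).
Proof.
move=> I; split; [exact: inv_cycle|exact: inv_fun|move=> e eD].
by rewrite -(inv_res I eD) lerDl inv_res_ge0.
Qed.

Lemma inv_init : ttc_inv (ttc_init D).
Proof.
have fl0 e : flow (st_output (ttc_init D)) e = 0.
  by rewrite /flow big1// => C; rewrite inE.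
split=> //=; try by move=> C; rewrite inE.
- by move=> e _; rewrite !inE.
- by move=> e eD; rewrite fl0 add0r ffunE.
- by move=> e eD; rewrite ffunE ltW// cap_gt0.
- by move=> v u w; rewrite fl0 ltxx.
- by move=> Y _ _ e ->.
Qed.

(** * Trading along cycles *)

Lemma flow_trade_cycle st C e : C \notin st_packing st ->
  flow (st_output (trade_cycle st C)) e =
  flow (st_output st) e + (if e \in C then min_on (st_res st) C else 0).
Proof.
move=> CNp; rewrite /flow /= big_mkcondr big_setU1//= ffunE eqxx addrC.
congr (_ + _); rewrite [RHS]big_mkcondr /=; apply: eq_bigr => B Bp.
rewrite ffunE; case: (eqVneq B C) => // BC.
by rewrite BC (negPf CNp) in Bp.
Qed.

Lemma trade_cycle_inv st C : ttc_inv st ->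
  dicycle (top_graph D (st_arcs st)) C ->
  (forall e, e \in C -> 0 < st_res st e) ->
  ttc_inv (trade_cycle st C) /\
  exists2 e, e \in C & st_res (trade_cycle st C) e = 0.
Proof.
move=> I CT C0; have sC := subsetP (dicycle_sub CT).
have sCE : {subset C <= st_arcs st}.
  by move=> e /sC/(subsetP (top_graph_sub _)).
have sCD : {subset C <= arcs D} by move=> e /sCE/(subsetP (inv_sub I)).
have CNp : C \notin st_packing st.
  apply/negP => /(inv_cut I)[e eC]; rewrite sCE//=.
  by rewrite gt_eqF ?C0.
have [e0 e0C] := dicycle_neq0 CT.
have [m mC [mE mmin]] := min_onP (st_res st) e0C.
have flE e := flow_trade_cycle e CNp.
have resE e : st_res (trade_cycle st C) e =
    if e \in C then st_res st e - min_on (st_res st) C else st_res st e.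
  by rewrite ffunE.
have m0 : st_res (trade_cycle st C) m = 0 by rewrite resE mC mE subrr.
split; last by exists m.
have out e : e \notin st_arcs st ->
    flow (st_output (trade_cycle st C)) e = flow (st_output st) e.
  move=> eN; rewrite flE ifN ?addr0//; apply: contra eN; exact: sCE.
split; rewrite ?[st_arcs _]/= ?[st_verts _]/=.
- exact: (inv_sub I).
- exact: (inv_ends I).
- move=> B; rewrite !inE => /predU1P[->|/(inv_cycle I)//].
  apply: dicycleS CT; exact: subset_trans (top_graph_sub _) (inv_sub I).
- move=> B; rewrite !inE ffunE; case: eqVneq => [_ _|_ /(inv_fun I)//].
  by rewrite mE C0.
- move=> e eD; rewrite flE resE -(inv_res I eD).
  by case: ifP => _; rewrite ?addr0// -addrA [X in _ + X]addrC subrK.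
- move=> e eD; rewrite resE; case: ifP => [eC|_]; last exact: (inv_res_ge0 I).
  by rewrite subr_ge0 mE mmin.
- move=> v u w; rewrite flE; case: ifP => [vuC _ vu vw wu|_].
    apply/negP => vwE; have [_ top] := mem_top_graph (sC _ vuC).
    have wNu : w != u by apply: contraTneq wu => ->; exact: pref_irr.
    by move: (pref_asym vu vw (top _ vwE wNu)); rewrite wu.
  by rewrite addr0; exact: (inv_pref I).
- move=> B; rewrite !inE => /predU1P[->|/(inv_cut I)[e eB eN]].
    by exists m => //; rewrite m0 eqxx orbT.
  exists e => //; case/orP: eN => [->//|e0E].
  rewrite resE; case: ifP => [/C0|_]; last by rewrite e0E orbT.
  by rewrite (eqP e0E) ltxx.
(* An agent preferring the old flow to [Y] would also prefer the new one: its deciding arc has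
   positive old flow, so the better arcs are deleted and unchanged, while the flow on the deciding
   arc can only grow. *)
- move=> Y YD W e eD eN; rewrite out//; apply: (inv_settled I) => // v.
  move=> [u [vu eYX ltYX]]; apply: (W v); exists u; split=> //.
    move=> w vw wu; rewrite out; first exact: eYX.
    apply: (inv_pref I _ vu vw wu); exact: le_lt_trans (flow_ge0 _ YD) ltYX.
  apply: lt_le_trans ltYX _; rewrite flE lerDl.
  by case: ifP => // _; rewrite mE ltW// C0.
Qed.

(** Trading one cycle leaves the working arcs, hence the top graph, unchanged and does not touch the
    residuals of the other cycles, which are disjoint from it. The clause on arcs outside all cycles
    carries the zero created by the first trade to the end. *)
Lemma trade_cycles_inv (s : seq {set V * V}) st : ttc_inv st -> uniq s ->
  (forall C, C \in s -> dicycle (top_graph D (st_arcs st)) C) ->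
  (forall C e, C \in s -> e \in C -> 0 < st_res st e) ->
  let st' := foldl (@trade_cycle R V) st s in
  [/\ ttc_inv st', st_arcs st' = st_arcs st, st_verts st' = st_verts st,
      forall e, (forall C, C \in s -> e \notin C) -> st_res st' e = st_res st e
    & s != [::] -> exists2 e, e \in st_arcs st & st_res st' e = 0].
Proof.
elim: s st => [|C s IHs] st I /=; first by split.
move=> /andP[CNs us] sT s0.
have CT : dicycle (top_graph D (st_arcs st)) C by apply: sT; exact: mem_head.
have C0 e : e \in C -> 0 < st_res st e by apply: s0; exact: mem_head.
have disj B e : B \in s -> e \in B -> e \notin C.
  move=> Bs eB; apply: contra CNs => eC.
  rewrite (top_cycle_inj CT _ eC eB)//.
    by apply: sT; rewrite inE Bs orbT.
have [I' [m mC m0]] := trade_cycle_inv I CT C0.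
have [||I2 EA EV Eres _] := IHs (trade_cycle st C) I' us.
- by move=> B Bs; apply: sT; rewrite inE Bs orbT.
- move=> B e Bs eB; rewrite ffunE (negPf (disj _ _ Bs eB)).
  by apply: (s0 B) => //; rewrite inE Bs orbT.
split=> //.
- move=> e eNs; rewrite Eres ?ffunE.
    by rewrite ifN// eNs// mem_head.
  by move=> B Bs; rewrite eNs// inE Bs orbT.
- move=> _; exists m.
    exact: (subsetP (subset_trans (dicycle_sub CT) (top_graph_sub _))).
  rewrite Eres// => B Bs; apply/negP => mB.
  by move: (disj _ _ Bs mB); rewrite mC.
Qed.

(** Kept outside [ttc_inv], like [sinkless], because it may fail in the middle of a round. *)
Definition unsaturated st := forall e, e \in st_arcs st -> 0 < st_res st e.

Definition sinkless st :=
  forall v, v \in st_verts st -> exists u, (v, u) \in st_arcs st.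

Lemma trade_inv st : ttc_inv st -> unsaturated st ->
  [/\ ttc_inv (trade D st), st_arcs (trade D st) = st_arcs st
    & st_verts st != set0 -> sinkless st ->
      exists2 e, e \in st_arcs st & st_res (trade D st) e = 0].
Proof.
move=> I U; have [|||I' EA _ _ sat] :=
    @trade_cycles_inv (enum (dicycles (top_graph D (st_arcs st)))) st I.
- exact: enum_uniq.
- by move=> C; rewrite mem_enum inE => /asboolP.
- move=> C e; rewrite mem_enum inE => /asboolP/dicycle_sub sC eC.
  exact/U/(subsetP (subset_trans sC (top_graph_sub _))).
split=> // V0 S; apply: sat.
have [|C CT] := top_cycle_exists (inv_sub I) V0 _ S.
  by move=> e /(inv_ends I)/andP[].
apply/eqP => E0; have : C \in enum (dicycles (top_graph D (st_arcs st))).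
  by rewrite mem_enum inE; apply/asboolP.
by rewrite E0.
Qed.

(** * Deleting saturated arcs and sinks *)

Lemma drop_saturated_inv st : ttc_inv st -> ttc_inv (drop_saturated st).
Proof.
move=> I; split; rewrite ?[st_verts _]/=.
- apply: subset_trans (inv_sub I).
  by apply/subsetP => e; rewrite inE => /andP[].
- by move=> e; rewrite inE => /andP[/(inv_ends I)].
- exact: (inv_cycle I).
- exact: (inv_fun I).
- exact: (inv_res I).
- exact: (inv_res_ge0 I).
- move=> v u w fu vu vw wu; rewrite inE negb_and.
  by rewrite (inv_pref I fu vu vw wu).
- move=> C /(inv_cut I)[e eC eN]; exists e => //=.
  by rewrite inE negb_and negbK eN.
- move=> Y YD W e eD; rewrite inE negb_and negbK.
  have [eE /= /eqP e0|eN _] := boolP (e \in st_arcs st); last first.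
    exact: (inv_settled I).
  have capE : flow (st_output st) e = cap D e.
    by rewrite -(inv_res I eD) e0 addr0.
  apply/eqP; rewrite eq_le; apply/andP; split.
    by rewrite [leRHS]capE; case: YD => _ _; exact.
  case: e eD eE e0 capE => v u vu _ _ capE.
  (* The flow equals a positive capacity, so [inv_pref] applies to the arcs preferred by [v]. *)
  apply: (not_prefers_le (W v) vu _) => w vw wu.
  apply/esym/(inv_settled I) => //; apply: (inv_pref I _ vu vw wu).
  by rewrite capE cap_gt0.
Qed.

Lemma drop_sinks_inv st : ttc_inv st -> ttc_inv (drop_sinks st).
Proof.
move=> I; have sub e : e \in st_arcs (drop_sinks st) -> e \in st_arcs st.
  by rewrite inE => /andP[].
split.
- by apply/subsetP => e /sub; exact/subsetP/inv_sub.
- by move=> e; rewrite inE => /andP[].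
- exact: (inv_cycle I).
- exact: (inv_fun I).
- exact: (inv_res I).
- exact: (inv_res_ge0 I).
- move=> v u w fu vu vw wu.
  by apply: contra (inv_pref I fu vu vw wu); exact: sub.
- move=> C /(inv_cut I)[e eC eN]; exists e => //=.
  by case/orP: eN => [eN|->]; rewrite ?orbT// (contra (@sub e) eN).
- move=> Y YD W [v u] vu; rewrite inE.
  have [vuE /=|vuN _] := boolP ((v, u) \in st_arcs st); last first.
    exact: (inv_settled I).
  have /andP[/= vV uV] := inv_ends I vuE.
  rewrite !inE vV uV /=.
  (* The arc itself shows that [v] is no sink, so its deletion means that [u] is one. *)
  have -> /= : [exists x, (v, x) \in st_arcs st] by apply/existsP; exists u.
  rewrite negb_exists => /forallP uN.
  have outE : \sum_(x | (x, u) \in arcs D) flow (st_output st) (x, u) =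
              \sum_(x | (x, u) \in arcs D) flow Y (x, u).
    rewrite -(is_exchange_balanced YD) -(is_exchange_balanced (inv_exchange I)).
    by apply: eq_bigr => x ux; rewrite (inv_settled I YD W ux (uN x)).
  have leY x : (x, u) \in arcs D ->
      flow (st_output st) (x, u) <= flow Y (x, u).
    move=> xu; have [f0|f0] := leP (flow (st_output st) (x, u)) 0.
      exact: le_trans f0 (flow_ge0 _ YD).
    apply: (not_prefers_le (W x) xu _) => w xw wu.
    exact/esym/(inv_settled I YD W xw)/(inv_pref I f0 xu xw wu).
  (* Termwise inequalities between equal sums are equalities. *)
  have [_] := leif_sum (fun x xu => leif_eq (leY x xu)).
  by rewrite outE eqxx => /esym/forall_inP/(_ v vu)/eqP.
Qed.

Lemma drop_sinks_sub st : st_arcs (drop_sinks st) \subset st_arcs st.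
Proof. by apply/subsetP => e; rewrite inE => /andP[]. Qed.

Lemma prune_inv st : ttc_inv st ->
  ttc_inv (prune st) /\ st_arcs (prune st) \subset st_arcs st.
Proof.
move=> I; rewrite /prune; elim: #|V| => //= n [I' sub].
split; first exact: drop_sinks_inv.
exact: subset_trans (drop_sinks_sub _) sub.
Qed.

Lemma st_res_prune st : st_res (prune st) = st_res st.
Proof. by rewrite /prune; elim: #|V| => //= n ->. Qed.

Lemma drop_sinks_sinkless st : ttc_inv st -> sinkless st ->
  sinkless (drop_sinks st).
Proof.
move=> I S v; rewrite inE => /andP[vV /existsP[u vu]].
have inW x : x \in st_verts st -> x \in st_verts (drop_sinks st).
  by move=> xV; rewrite inE xV; apply/existsP/S.
have /andP[/= _ uV] := inv_ends I vu.
by exists u; rewrite inE vu /= !inW.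
Qed.

(** After [n] iterations either no sink is left or at least [n] vertices are gone; for [n] equal to
    [#|V|] the second case leaves no vertex at all. *)
Lemma prune_sinkless st : ttc_inv st -> sinkless (prune st).
Proof.
move=> I.
have step n : sinkless (iter n (@drop_sinks R V) st) \/
    (#|st_verts (iter n (@drop_sinks R V) st)| + n <= #|V|)%N.
  elim: n => [|n [S|le]] /=; first by right; rewrite addn0 max_card.
    left; apply: drop_sinks_sinkless S.
    by elim: n => //= n; exact: drop_sinks_inv.
  set st1 := iter n _ _ in le *.
  have I1 : ttc_inv st1.
    by rewrite /st1; elim: (n) => //= k; exact: drop_sinks_inv.
  have sub : st_verts (drop_sinks st1) \subset st_verts st1.
    by apply/subsetP => v; rewrite inE => /andP[].
  have [eqV|neV] := eqVneq (st_verts (drop_sinks st1)) (st_verts st1).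
    (* If no vertex was deleted, each had an outgoing arc already. *)
    left; apply: drop_sinks_sinkless => // v.
    by rewrite -eqV inE => /andP[_ /existsP].
  right; apply: leq_trans le; rewrite addnS -addSn leq_add2r.
  by apply: proper_card; rewrite properEneq neV.
case: (step #|V|) => // ; rewrite -[leqRHS]add0n leq_add2r leqn0 cards_eq0.
by move=> /eqP V0 v; rewrite V0 inE.
Qed.

(** * Rounds, termination and Pareto optimality *)

Lemma ttc_round_inv st : ttc_inv st -> unsaturated st ->
  let st' := ttc_round D st in
  [/\ ttc_inv st', unsaturated st', sinkless st'
    & st_verts st != set0 -> sinkless st ->
      (#|st_arcs st'| < #|st_arcs st|)%N].
Proof.
move=> I U; have [IT EA prog] := trade_inv I U.
have ID := drop_saturated_inv IT; have [IP sub] := prune_inv ID.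
split=> //; last 2 first.
- exact: prune_sinkless.
- move=> V0 S; have [e eE e0] := prog V0 S.
  apply/proper_card/properP; split.
    apply: subset_trans sub _; apply/subsetP => x.
    by rewrite inE EA => /andP[].
  by exists e => //; apply/negP => /(subsetP sub); rewrite inE e0 eqxx andbF.
- move=> e eE; rewrite /ttc_round st_res_prune lt_neqAle eq_sym.
  have := subsetP sub _ eE; rewrite inE => /andP[_ ->] /=.
  by apply: (inv_res_ge0 IT); exact: (subsetP (inv_sub IP)).
Qed.

(** The measure counts the arcs left after one round: the input graph may have sinks, and the strict
    decrease needs a sinkless state, which is only guaranteed once a round has pruned it. *)
Lemma ttc_run_inv st : ttc_inv st -> unsaturated st -> exists st',
  [/\ ttc_run D st (st_output st'), ttc_inv st' & st_verts st' = set0].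
Proof.
move=> I U; have [I1 U1 S1 _] := ttc_round_inv I U.
have [n] := ubnP #|st_arcs (ttc_round D st)|.
elim: n => // n IHn in st I U I1 U1 S1 *; rewrite ltnS => le.
have [V0|V0] := eqVneq (st_verts (ttc_round D st)) set0.
  by exists (ttc_round D st); split=> //; exact: ttc_stop.
have [I2 U2 S2 /(_ V0 S1) lt] := ttc_round_inv I1 U1.
have [st' [run I' V']] := IHn _ I1 U1 I2 U2 S2 (leq_trans lt le).
by exists st'; split=> //; apply: ttc_next run => //; exact/eqP.
Qed.

(** A dominating exchange meets the premise of [inv_settled]; with no vertex left it agrees with the
    output on every arc, so no agent gains strictly. *)
Lemma inv_pareto st : ttc_inv st -> st_verts st = set0 ->
  pareto_optimal D (st_output st).
Proof.
move=> I V0 [Y [YD [nw [u [x [ux _]]]]]].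
rewrite (inv_settled I YD _ ux) ?ltxx//.
  by move=> v XY; apply: nw; exists v.
by apply/negP => /(inv_ends I); rewrite V0 inE.
Qed.

End TopTradingCyclesTheory.

Theorem theorem1 (R : realType) (V : finType) (D : px_instance R V) :
  exists X : exchange R V,
    [/\ ttc_run D (ttc_init D) X,
        is_exchange D X,
        balanced D X
      & pareto_optimal D X].
Proof.
have [|st [run I V0]] := ttc_run_inv (inv_init D).
  by move=> e eD; rewrite ffunE cap_gt0.
exists (st_output st); split=> //.
- exact: inv_exchange.
- exact/is_exchange_balanced/inv_exchange.
- exact: inv_pareto.
Qed.
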